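(* Let $n,r$ be nonnegative integers with $2\leq r\leq\lceil n/2\rceil$. Then there is a stable configuration $K^*$, reachable from the pulse $K(n,r)$ by a finite sequence of firing moves, such that $K^*\neq \mathrm{Az}(n)$.
   Context: The grid complex is the tiling of the plane by unit squares (''faces''); two faces are adjacent if they share an edge, and $\mathrm{dist}(f,g)$ is the Manhattan distance between faces. A configuration $K$ assigns an integer weight $K_f$ to each face $f$, with finitely many nonzero weights; there is a marked face $f_0$ with $K_{f_0}=n$. Firing moves: (i) if $f,g$ are adjacent faces, both different from $f_0$, with $K_f\geq K_g+2$, one may fire $f$ towards $g$, decreasing $K_f$ by $1$ and increasing $K_g$ by $1$; (ii) if $g$ is adjacent to $f_0$ and $K_g<n$, one may fire from $f_0$ to $g$, increasing $K_g$ by $1$; (iii) if $g$ is adjacent to $f_0$ and $K_g>n$, one may fire from $g$ to $f_0$, decreasing $K_g$ by $1$; the weight of $f_0$ never changes. A configuration is stable if no firing move is possible. The pulse $K(n,r)$ has $K(n,r)_f=n$ if $\mathrm{dist}(f_0,f)\leq r$ and $0$ otherwise. The Aztec diamond $\mathrm{Az}(n)$ has $\mathrm{Az}(n)_{f_0}=n$ and $\mathrm{Az}(n)_f=\max\{n-\mathrm{dist}(f_0,f)+1,0\}$ for $f\neq f_0$. *)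

(* Defs.v *)
From Stdlib Require Import Relation_Operators.
From mathcomp Require Import all_boot all_order all_algebra.
From mathcomp Require Import finmap zify.

Set Implicit Arguments.
Unset Strict Implicit.
Unset Printing Implicit Defensive.

Import Order.TTheory GRing.Theory Num.Theory.
Local Open Scope fset_scope.
Local Open Scope ring_scope.

(* The pair (x, y) stands for the unit square [x, x+1] x [y, y+1]. *)
Definition face : Type := (int * int)%type.

Definition adjacent (f g : face) : bool :=
  ((f.1 == g.1) && (`|f.2 - g.2| == 1)) ||
  ((f.2 == g.2) && (`|f.1 - g.1| == 1)).

Definition dist (f g : face) : nat := (`|f.1 - g.1| + `|f.2 - g.2|)%N.

Definition config : Type := {fsfun face -> int with 0}.

(* Only used as finite sets containing the supports of [pulse] and [aztec]. *)
Definition ball_box (f0 : face) (r : nat) : {fset face} :=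
  [fset (f0.1 - r%:Z + i%:Z, f0.2 - r%:Z + j%:Z)
     | i in iota 0 r.*2.+1, j in iota 0 r.*2.+1].

Definition ball (f0 : face) (r : nat) : {fset face} :=
  [fset f in ball_box f0 r | (dist f0 f <= r)%N].

Lemma in_ball (f0 : face) (r : nat) (f : face) :
  (f \in ball f0 r) = (dist f0 f <= r)%N.
Proof.
rewrite !inE /=; apply: andb_idl; rewrite /dist => le_r.
have coord (a b : int) : (`|a - b| <= r)%N ->
    exists2 i : nat, i \in iota 0 r.*2.+1 & (b = a - r%:Z + i%:Z)%R.
  move=> le_ab; exists `|(b - a + r%:Z)%R|%N.
    by rewrite mem_iota; lia.
  by lia.
have [|i i_in E1] := coord f0.1 f.1; first by apply: leq_trans le_r; lia.
have [|j j_in E2] := coord f0.2 f.2; first by apply: leq_trans le_r; lia.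
apply/imfset2P; exists i => //; exists j => //.
by rewrite -E1 -E2 -surjective_pairing.
Qed.

Definition pulse (f0 : face) (n r : nat) : config :=
  [fsfun f in ball f0 r => n%:Z | 0].

Lemma pulseE (f0 : face) (n r : nat) (f : face) :
  pulse f0 n r f = if (dist f0 f <= r)%N then n%:Z else 0.
Proof. by rewrite fsfun_fun in_ball. Qed.

Definition aztec (f0 : face) (n : nat) : config :=
  [fsfun f in ball f0 n =>
     if f == f0 then n%:Z else Num.max (n%:Z - (dist f0 f)%:Z + 1) 0 | 0].

Lemma aztecE (f0 : face) (n : nat) (f : face) :
  aztec f0 n f =
    if f == f0 then n%:Z else Num.max (n%:Z - (dist f0 f)%:Z + 1) 0.
Proof.
rewrite fsfun_fun in_ball; case: leqP => // lt_n.
case: eqP lt_n => [->|_ lt_n]; first by rewrite /dist; lia.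
by lia.
Qed.

Inductive firing (f0 : face) (n : nat) (K : config) : config -> Prop :=
| fire_faces (f g : face) of
    adjacent f g & f != f0 & g != f0 & K g + 2 <= K f :
    firing f0 n K [fsfun K with f |-> K f - 1, g |-> K g + 1]
| fire_from_marked (g : face) of adjacent g f0 & K g < n%:Z :
    firing f0 n K [fsfun K with g |-> K g + 1]
| fire_to_marked (g : face) of adjacent g f0 & n%:Z < K g :
    firing f0 n K [fsfun K with g |-> K g - 1].

Definition reachable (f0 : face) (n : nat) : config -> config -> Prop :=
  clos_refl_trans config (firing f0 n).

Definition stable (f0 : face) (n : nat) (K : config) : Prop :=
  forall K' : config, ~ firing f0 n K K'.

Lemma adjacent_irrefl (f : face) : adjacent f f = false.
Proof. by rewrite /adjacent !subrr normr0 !andbF. Qed.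

Lemma firing_marked (f0 : face) (n : nat) (K K' : config) :
  firing f0 n K K' -> K' f0 = K f0.
Proof.
have adj_neq (g : face) : adjacent g f0 -> (f0 == g) = false.
  by case: eqP => // <-; rewrite adjacent_irrefl.
case=> [f g _ nf ng _|g adj _|g adj _]; rewrite !fsfun_withE; last 2 first.
- by rewrite adj_neq.
- by rewrite adj_neq.
by rewrite !(eq_sym f0) (negPf nf) (negPf ng).
Qed.

(* Hence the condition K f0 = n on configurations need not be restated. *)
Lemma reachable_marked (f0 : face) (n : nat) (K K' : config) :
  reachable f0 n K K' -> K f0 = n%:Z -> K' f0 = n%:Z.
Proof.
elim=> [{}K {}K' /firing_marked-> // | // | K1 K2 K3 _ IH12 _ IH23 ?].
exact/IH23/IH12.
Qed.

(* Main.v *)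
(* Az(n) vanishes at distance n + 1, and a positive weight never becomes zero
   again, because firing f towards g needs K f >= K g + 2 >= 2; so it suffices
   to bring one unit of weight to a face at distance n + 1.

   Let p j = f0 + (1, j), at distance j + 1 from f0, and let q = f0 + (0, 2),
   which is adjacent to p 2 and has weight n in the pulse.  Stabilise without
   ever changing the weight of q.  Then p 0 has weight n and the weights along
   p are 1-Lipschitz; if p n still has weight 0, the weight of p j is exactly
   n - j.  Now fire q towards p 2, then p 2 towards p 3, and so on: one unit
   travels along p and arrives at p n.  Finally stabilise without restriction.

   Firing terminates, since the weights stay in [0, n], their support stays in
   a fixed ball, and the sum of (n - K f)^2 over that ball decreases. *)
Require Import Defs.
From Stdlib Require Import Relation_Operators Classical.
From mathcomp Require Import all_boot all_order all_algebra.
From mathcomp Require Import finmap zify.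

Set Implicit Arguments.
Unset Strict Implicit.
Unset Printing Implicit Defensive.

Import Order.TTheory GRing.Theory Num.Theory.
Local Open Scope fset_scope.
Local Open Scope ring_scope.

(** The bound on weight plus distance survives a move from [f] to [g]: the new [K g + 1] is at most
    [K f - 1], while the distance grows by at most one. A bound on the support alone would not be
    inductive. *)
Definition bounded (f0 : face) (n m : nat) (K : config) : Prop :=
  forall f, [/\ 0 <= K f, K f <= n%:Z & 0 < K f -> K f + (dist f0 f)%:Z <= m%:Z].

Lemma pulse_bounded f0 n r : bounded f0 n (n + r) (pulse f0 n r).
Proof. by move=> f; rewrite pulseE; case: ifP => le_r; split=> //; lia. Qed.

Lemma adjacent_dist f0 f g : adjacent f g -> (dist f0 g <= (dist f0 f).+1)%N.
Proof. by rewrite /adjacent /dist; lia. Qed.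

Lemma adjacent_dist1 f0 g : adjacent g f0 -> dist f0 g = 1%N.
Proof. by rewrite /adjacent /dist; lia. Qed.

Lemma adjacent_neq f g : adjacent f g -> f != g.
Proof. by apply: contraTneq => ->; rewrite adjacent_irrefl. Qed.

Lemma firing_bounded f0 n m K K' :
  (n < m)%N -> bounded f0 n m K -> firing f0 n K K' -> bounded f0 n m K'.
Proof.
move=> lt_nm bK [f g adj _ _ le2|g adj lt|g adj lt] h.
- have [hf0 hfn hfm] := bK f; have [hg0 hgn hgm] := bK g.
  have := adjacent_dist f0 adj.
  have [h0 hn hm] := bK h.
  rewrite !fsfun_withE; case: (h =P f) => [->|_]; first by split; lia.
  by case: (h =P g) => [->|_]; split; lia.
- have [h0 hn hm] := bK h; have [hg0 hgn hgm] := bK g.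
  have := adjacent_dist1 adj.
  by rewrite fsfun_withE; case: (h =P g) => [->|_]; split; lia.
- by have [] := bK g; lia.
Qed.

Lemma firing_gt0 f0 n m K K' (f : face) :
  bounded f0 n m K -> firing f0 n K K' -> 0 < K f -> 0 < K' f.
Proof.
move=> bK [g h _ _ _ le2|g _ lt|g _ lt] Kf.
- have [h0 _ _] := bK h; rewrite !fsfun_withE.
  by case: (f =P g) => _; last case: (f =P h) => [_|_]; lia.
- by rewrite fsfun_withE; case: (f =P g) => [<-|_]; lia.
- by have [] := bK g; lia.
Qed.

Definition energy (f0 : face) (n m : nat) (K : config) : nat :=
  \sum_(f <- ball f0 m) `|n%:Z - K f| ^ 2.

(** Put [a = n - K f] and [b = n - K g]. A move between faces has [b >= a + 2], so
    [(a + 1)^2 + (b - 1)^2 < a^2 + b^2]; a move out of [f0] has [b >= 1] and lowers [b^2]. Moves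
    into [f0] are excluded by [K g <= n]. *)
Lemma firing_energy f0 n m K K' :
  (n < m)%N -> bounded f0 n m K -> firing f0 n K K' ->
  (energy f0 n m K' < energy f0 n m K)%N.
Proof.
move=> lt_nm bK; rewrite /energy; case=> [f g adj _ _ le2|g adj lt|g adj lt].
- have [hf0 hfn hfm] := bK f; have [hg0 hgn hgm] := bK g.
  have ngf : (g == f) = false by rewrite eq_sym (negPf (adjacent_neq adj)).
  have fB : f \in ball f0 m by rewrite in_ball; lia.
  (* Even if [K g = 0]: since [K f >= 2], [f] is at distance at most [m - 2]. *)
  have gB : g \in ball f0 m `\ f.
    by rewrite in_fsetD1 ngf in_ball; have := adjacent_dist f0 adj; lia.
  rewrite !(big_fsetD1 f fB) /= !(big_fsetD1 g gB) /=.
  rewrite !fsfun_withE !eqxx ngf.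
  set S := (\sum_(_ <- _) _)%N; set S' := (\sum_(_ <- _) _)%N.
  have -> : S = S'.
    apply: eq_big_seq => h; rewrite !in_fsetD1 => /and3P[hg hf _].
    by rewrite !fsfun_withE (negPf hg) (negPf hf).
  nia.
- have [hg0 hgn hgm] := bK g.
  have gB : g \in ball f0 m by rewrite in_ball (adjacent_dist1 adj); lia.
  rewrite !(big_fsetD1 g gB) /= fsfun_withE eqxx.
  set S := (\sum_(_ <- _) _)%N; set S' := (\sum_(_ <- _) _)%N.
  have -> : S = S'.
    apply: eq_big_seq => h; rewrite in_fsetD1 => /andP[hg _].
    by rewrite fsfun_withE (negPf hg).
  nia.
- by have [] := bK g; lia.
Qed.

Lemma reachable_bounded f0 n m K K' :
  (n < m)%N -> reachable f0 n K K' -> bounded f0 n m K -> bounded f0 n m K'.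
Proof.
move=> lt_nm; elim=> [{}K {}K' s bK|//|K1 K2 K3 _ IH1 _ IH2 /IH1/IH2//].
exact: firing_bounded bK s.
Qed.

Lemma reachable_gt0 f0 n m K K' (f : face) :
  (n < m)%N -> bounded f0 n m K -> reachable f0 n K K' -> 0 < K f -> 0 < K' f.
Proof.
move=> lt_nm bK s; elim: s bK => [{}K {}K' s|//|K1 K2 K3 s1 IH1 _ IH2] bK.
  exact: firing_gt0 s.
by move=> /(IH1 bK); apply: IH2; apply: reachable_bounded s1 bK.
Qed.

(** Induction on the energy. A general [R] covers both the stabilisation with one weight frozen and
    the unrestricted one. *)
Lemma exists_normal_form f0 n m (R : config -> config -> Prop) K :
    (forall K1 K2, R K1 K2 -> firing f0 n K1 K2) ->
    (n < m)%N -> bounded f0 n m K ->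
  exists K', clos_refl_trans config R K K' /\ forall K'', ~ R K' K''.
Proof.
move=> subR lt_nm.
have [e] := ubnP (energy f0 n m K); elim: e K => // e IH K le_e bK.
have [[K1 RK1]|nR] := classic (exists K1, R K K1); last first.
  by exists K; split; [apply: rt_refl|move=> K1 RK1; apply: nR; exists K1].
have s := subR _ _ RK1.
have [||K' [s' nf]] := IH K1; last exists K'.
- by have := firing_energy lt_nm bK s; lia.
- exact: firing_bounded bK s.
- by split=> //; apply: rt_trans s'; apply: rt_step.
Qed.

Definition ray (f0 : face) (j : nat) : face := (f0.1 + 1, f0.2 + j%:Z).

Lemma dist_ray f0 j : dist f0 (ray f0 j) = j.+1.
Proof. by rewrite /dist /=; lia. Qed.

Lemma ray_neq f0 j : ray f0 j != f0.
Proof. by apply/eqP => E; have := dist_ray f0 j; rewrite E /dist; lia. Qed.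

Lemma ray_eq f0 i j : (ray f0 i == ray f0 j) = (i == j).
Proof. by rewrite xpair_eqE /= eqxx /=; lia. Qed.

Lemma adjacent_ray f0 j : adjacent (ray f0 j) (ray f0 j.+1).
Proof. by rewrite /adjacent /=; lia. Qed.

(** The hypotheses describe one surplus unit at [ray f0 k]. The gap to the next face is exactly 2,
    and firing restores the same hypotheses with [k + 1] for [k]. At [k = n] the surplus is the
    whole weight, 1. *)
Lemma propagate_along_ray f0 n (K : config) k :
    (k <= n)%N -> K (ray f0 k) = n%:Z - k%:Z + 1 ->
    (forall j, (k < j <= n)%N -> K (ray f0 j) = n%:Z - j%:Z) ->
  exists2 K', reachable f0 n K K' & 0 < K' (ray f0 n).
Proof.
move=> le_kn; rewrite -(subKn le_kn); move: (leq_subr k n).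
elim: (n - k)%N K => [|i IH] K le_in Kk Kj.
  by exists K; [apply: rt_refl|move: Kk; rewrite subn0; lia].
have E : (n - i = (n - i.+1).+1)%N by lia.
have Ki := Kj (n - i)%N ltac:(lia).
have adj : adjacent (ray f0 (n - i.+1)) (ray f0 (n - i)).
  by rewrite E adjacent_ray.
have le2 : K (ray f0 (n - i)) + 2 <= K (ray f0 (n - i.+1)) by lia.
have := fire_faces n adj (ray_neq f0 _) (ray_neq f0 _) le2.
set K1 := (X in firing _ _ _ X) => s.
have [|||K' s' pos] := IH K1; first exact: ltnW.
- by rewrite !fsfun_withE !ray_eq eqxx ifN; lia.
- move=> j lt_j; rewrite !fsfun_withE !ray_eq.
  by do 2?[rewrite ifN; last lia]; apply: Kj; lia.
- by exists K' => //; apply: rt_trans s'; apply: rt_step s.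
Qed.

Lemma exists_ray_gt0 f0 n r : (2 <= r)%N -> (2 <= n)%N ->
  exists2 K, reachable f0 n (pulse f0 n r) K & 0 < K (ray f0 n).
Proof.
move=> le2r le2n; pose q : face := (f0.1, f0.2 + 2).
have lt_nm : (n < n + r)%N by lia.
(* As the ray avoids [q], moves along it are [R]-moves, hence impossible in an [R]-normal form. *)
have ray_q j : ray f0 j != q by rewrite xpair_eqE /=; lia.
have q_f0 : q != f0 by rewrite -pair_eqE /=; lia.
pose R K K' := firing f0 n K K' /\ K' q = K q.
have [|K [sR nf]] := @exists_normal_form f0 n _ R _ _ lt_nm (pulse_bounded f0 n r).
  by move=> ? ? [].
have [s Kq] : reachable f0 n (pulse f0 n r) K /\ K q = n%:Z.
  (* Here [2 <= r] enters: [q] is at distance 2. *)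
  have -> : n%:Z = pulse f0 n r q by rewrite pulseE /dist /=; case: ifP => //; lia.
  elim: sR {nf} => [K1 K2 [s eq]|K1|K1 K2 K3 _ [s1 e1] _ [s2 e2]].
  - by split=> //; apply: rt_step.
  - by split=> //; apply: rt_refl.
  - by split; [apply: rt_trans s2|rewrite e2].
have bK := reachable_bounded lt_nm s (pulse_bounded f0 n r).
have [Kpos|Kn] := ltP 0 (K (ray f0 n)); first by exists K.
have K0 : K (ray f0 0) = n%:Z.
  have [_ le_n _] := bK (ray f0 0); apply/eqP; rewrite eq_le le_n leNgt /=.
  apply/negP => lt; have adj : adjacent (ray f0 0) f0 by rewrite /adjacent /=; lia.
  apply: (nf _ (conj (fire_from_marked adj lt) _)).
  by rewrite fsfun_withE eq_sym (negPf (ray_q 0)).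
have lip i j : adjacent (ray f0 i) (ray f0 j) -> K (ray f0 i) <= K (ray f0 j) + 1.
  move=> adj; rewrite leNgt; apply/negP => lt.
  have le2 : K (ray f0 j) + 2 <= K (ray f0 i) by lia.
  apply: (nf _ (conj (fire_faces n adj (ray_neq _ _) (ray_neq _ _) le2) _)).
  by rewrite !fsfun_withE !ifN // eq_sym.
(* Outward from weight [n] at [ray f0 0], each step loses at most one. *)
have lo j : n%:Z - j%:Z <= K (ray f0 j).
  elim: j => [|j IH]; first by rewrite K0; lia.
  by have := lip j j.+1 (adjacent_ray f0 j); lia.
(* Inward from weight 0 at [ray f0 n], each step gains at most one. *)
have hi i : (i <= n)%N -> K (ray f0 (n - i)) <= i%:Z.
  elim: i => [|i IH] lt; first by rewrite subn0.
  have E : (n - i = (n - i.+1).+1)%N by lia.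
  have := lip (n - i.+1)%N (n - i)%N; rewrite {1}E => /(_ (adjacent_ray _ _)).
  by have := IH (ltnW lt); lia.
have Kj j : (j <= n)%N -> K (ray f0 j) = n%:Z - j%:Z.
  by move=> le_jn; have := lo j; have := hi (n - j)%N; rewrite subKn //; lia.
have adj : adjacent q (ray f0 2) by rewrite /adjacent /=; lia.
(* The weights are [n - 2] and [n], just enough to fire. *)
have le2 : K (ray f0 2) + 2 <= K q by rewrite Kq Kj //; lia.
have := fire_faces n adj q_f0 (ray_neq f0 2) le2.
set K1 := (X in firing _ _ _ X) => s'.
have [||K' s'' pos] := @propagate_along_ray f0 n K1 2 le2n.
- by rewrite !fsfun_withE (negPf (ray_q 2)) eqxx Kj.
- move=> j lt_j; rewrite !fsfun_withE (negPf (ray_q j)) ray_eq ifN; last lia.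
  by apply: Kj; lia.
- by exists K' => //; apply: rt_trans s''; apply: rt_trans s _; apply: rt_step s'.
Qed.

Theorem theorem5p6 (f0 : face) (n r : nat) (hr2 : (2 <= r)%N)
    (hrn : (r <= uphalf n)%N) :
  exists Kstar : config,
    stable f0 n Kstar /\
    reachable f0 n (pulse f0 n r) Kstar /\
    Kstar <> aztec f0 n.
Proof.
(* From [2 <= r <= uphalf n] follows [3 <= n]. *)
have [||K s Kpos] := @exists_ray_gt0 f0 n r; [lia|lia|].
have lt_nm : (n < n + r)%N by lia.
have bK := reachable_bounded lt_nm s (pulse_bounded f0 n r).
have [K' [s' nf]] := exists_normal_form (fun _ _ => id) lt_nm bK.
exists K'; split; first exact: nf.
split; first exact: rt_trans s s'.
have := reachable_gt0 lt_nm bK s' Kpos => + E.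
by rewrite E aztecE (negPf (ray_neq f0 n)) dist_ray; lia.
Qed.
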